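(* Let $(V,V^+,e_V)$ and $(W,W^+,e_W)$ be function systems. Put $$V^+\otimes W^+ := \Big\{\sum_{i=1}^n v_i\otimes w_i\in V\otimes W : n\in\mathbb N,\ v_i\in V^+,\ w_i\in W^+\Big\}$$ and $$D:=\{z\in V\otimes W : \forall \varepsilon>0,\ z+\varepsilon\, e_V\otimes e_W\in V^+\otimes W^+\}.$$ Then the maximal tensor product $V\otimes_{\max}W$ coincides with the Archimedeanization $(V\otimes W, D, e_V\otimes e_W)$ of the ordered real vector space with order unit $(V\otimes W, V^+\otimes W^+, e_V\otimes e_W)$; that is, $D\cap -D=\{0\}$ and $(V\otimes_{\max}W)^+=D$.
   Context: An ordered real vector space is a real vector space $V$ with a (convex) cone $V^+$ such that $V^+\cap -V^+=\{0\}$; $v\ge w$ means $v-w\in V^+$. An element $e\in V$ is an order unit if for each $v\in V$ there is $r>0$ with $re\ge v$. An order unit $e$ is Archimedean if $\varepsilon e+v\in V^+$ for all $\varepsilon>0$ implies $v\in V^+$. A function system is an ordered real vector space with an Archimedean order unit. Archimedeanization: for an ordered real vector space $(V,V^+)$ with order unit $e$, let $D=\{v\in V:\varepsilon e+v\in V^+\text{ for all }\varepsilon>0\}$ and $N=D\cap -D$. The Archimedeanization is $(V/N, D+N, e+N)$. Maximal tensor product: let $(V\otimes W)^d$ be the algebraic dual of the algebraic (real) tensor product $V\otimes W$, and let $S_{\max}(V\otimes W)=\{r\in (V\otimes W)^d : r(v\otimes w)\ge 0 \text{ for all } v\in V^+, w\in W^+,\ r(e_V\otimes e_W)=1\}$.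 Elements of $V\otimes W$ are regarded as functions on $S_{\max}(V\otimes W)$ by evaluation, and $V\otimes_{\max}W$ is $V\otimes W$ with the order induced from functions on $S_{\max}(V\otimes W)$, i.e. $(V\otimes_{\max}W)^+=\{z\in V\otimes W: r(z)\ge 0\ \forall r\in S_{\max}(V\otimes W)\}$, with order unit $e_V\otimes e_W$. *)

(* Defs.v *)
From HB Require Import structures.
From mathcomp Require Import all_boot all_order all_algebra.
From mathcomp Require Import all_classical reals.
From mathcomp Require Import freeg.

Set Implicit Arguments.
Unset Strict Implicit.
Unset Printing Implicit Defensive.

Import Order.TTheory GRing.Theory Num.Theory.
Local Open Scope classical_set_scope.
Local Open Scope ring_scope.
Local Open Scope quotient_scope.

Section LinearQuotient.
Variables (R : realType) (V : lmodType R) (S : set V).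

Definition lspan : {pred V} :=
  fun v => `[< forall U : {pred V}, submod_closed U ->
                 (forall x, S x -> x \in U) -> v \in U >].

Lemma lspan_submod : submod_closed lspan.
Proof.
split=> [|a u v /asboolP hu /asboolP hv]; apply/asboolP => U hU SU.
  by case: hU.
by case: (hU) => _; apply; [exact: hu | exact: hv].
Qed.

HB.instance Definition _ := GRing.isSubmodClosed.Build R V lspan lspan_submod.

Definition lquot := Quotient.quot lspan.

HB.instance Definition _ := GRing.Zmodule.on lquot.

Definition lproj (v : V) : lquot := \pi_(Quotient.quot lspan) v.

Lemma lproj_eq u v : lproj u = lproj v <-> u - v \in lspan.
Proof. by rewrite Quotient.idealrBE; split=> [|/eqP//]; move=> h; apply/eqP. Qed.

Lemma lproj_zmod : zmod_morphism lproj.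
Proof. by move=> u v; rewrite /lproj raddfB. Qed.

Lemma lproj_surj (x : lquot) : exists v, x = lproj v.
Proof. by exists (repr x); rewrite /lproj reprK. Qed.

Definition lquot_scale (a : R) (x : lquot) : lquot :=
  lproj (a *: (repr x : V)).

Lemma lquot_scaleE a v : lquot_scale a (lproj v) = lproj (a *: v).
Proof.
apply/lproj_eq; rewrite -scalerBr rpredZ //.
by apply/lproj_eq; rewrite /lproj reprK.
Qed.

Fact lprojD u v : lproj (u + v) = lproj u + lproj v.
Proof. by rewrite /lproj raddfD. Qed.

Fact lquot_scaleA a b x :
  lquot_scale a (lquot_scale b x) = lquot_scale (a * b) x.
Proof. by have [v ->] := lproj_surj x; rewrite !lquot_scaleE scalerA. Qed.

Fact lquot_scale1 : left_id 1 lquot_scale.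
Proof. by move=> x; have [v ->] := lproj_surj x; rewrite lquot_scaleE scale1r. Qed.

Fact lquot_scaleDr : right_distributive lquot_scale +%R.
Proof.
move=> a x y; have [u ->] := lproj_surj x; have [v ->] := lproj_surj y.
by rewrite -lprojD !lquot_scaleE scalerDr lprojD.
Qed.

Fact lquot_scaleDl x : {morph lquot_scale^~ x : a b / a + b}.
Proof.
move=> a b; have [u ->] := lproj_surj x.
by rewrite !lquot_scaleE scalerDl lprojD.
Qed.

HB.instance Definition _ := GRing.Zmodule_isLmodule.Build R lquot
  lquot_scaleA lquot_scale1 lquot_scaleDr lquot_scaleDl.

Fact lproj_linear : linear lproj.
Proof. by move=> a u v; rewrite lprojD -lquot_scaleE. Qed.

HB.instance Definition _ := GRing.isLinear.Build R V lquot *:%R lproj lproj_linear.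

End LinearQuotient.

(** Algebraic tensor product: the free vector space on [V * W] modulo the
    bilinearity relations. *)

Section Tensor.
Variables (R : realType) (V W : lmodType R).

Definition free_pair (v : V) (w : W) : {freeg (V * W) / R} := << (v, w) >>.

Definition bilin_rel : set {freeg (V * W) / R} :=
  [set x | (exists a v v' w, x = free_pair (a *: v + v') w
              - (a *: free_pair v w + free_pair v' w)) \/
           (exists a v w w', x = free_pair v (a *: w + w')
              - (a *: free_pair v w + free_pair v w'))].

Definition tensor : lmodType R := lquot bilin_rel.

Definition tmul (v : V) (w : W) : tensor := lproj bilin_rel (free_pair v w).

End Tensor.

Notation "v \ox w" := (tmul v w) (at level 40, left associativity).

Section TensorTheory.
Variables (R : realType) (V W : lmodType R).

Lemma tmul_linearl (w : W) : linear (fun v : V => v \ox w).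
Proof.
move=> a v v'; rewrite /tmul -linearP; apply/lproj_eq/asboolP => U _; apply.
by left; exists a, v, v', w.
Qed.

Lemma tmul_linearr (v : V) : linear (fun w : W => v \ox w).
Proof.
move=> a w w'; rewrite /tmul -linearP; apply/lproj_eq/asboolP => U _; apply.
by right; exists a, v, w, w'.
Qed.

Lemma tensor_ind (P : tensor V W -> Prop) :
  P 0 -> (forall a v w x, P x -> P (a *: (v \ox w) + x)) -> forall z, P z.
Proof.
move=> P0 PD z; have [x ->] := lproj_surj z.
elim/freeg_ind_dom0: x => [|a [v w] D _ _ ih]; first by rewrite linear0.
have -> : << a *g (v, w) >> = a *: free_pair v w.
  by apply/eqP/freeg_eqP => k; rewrite coeffZ !coeffU mul1r.
by rewrite linearP; exact: PD.
Qed.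

Lemma tensor_universal (U : lmodType R) (f : V -> W -> U) :
  (forall w, linear (f^~ w)) -> (forall v, linear (f v)) ->
  exists2 g : {linear tensor V W -> U},
    (forall v w, g (v \ox w) = f v w) &
    forall g' : {linear tensor V W -> U},
      (forall v w, g' (v \ox w) = f v w) -> g' =1 g.
Proof.
move=> fl fr; pose L : {freeg (V * W) / R} -> U := fglift (fun p => f p.1 p.2).
have LB : {morph L : x y / x - y} by exact: lift_is_additive.
have L0 : L 0 = 0 by rewrite -(subrr 0) LB subrr.
have LD : {morph L : x y / x + y}.
  by move=> x y; rewrite -[y in LHS]opprK -[- y]sub0r !LB L0 sub0r opprK.
have LU a v w : L << a *g (v, w) >> = a *: f v w by rewrite /L liftU.
have LZ a x : L (a *: x) = a *: L x.
  elim/freeg_ind_dom0: x => [|b [v w] D _ _ ih]; first by rewrite scaler0 L0 scaler0.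
  have -> : a *: (<< b *g (v, w) >> + D) = << (a * b) *g (v, w) >> + a *: D.
    rewrite scalerDr; congr (_ + _).
    by apply/eqP/freeg_eqP => k; rewrite coeffZ !coeffU mulrA.
  by rewrite !LD ih !LU scalerDr scalerA.
have Lker x : x \in lspan (@bilin_rel R V W) -> L x = 0.
  move=> /asboolP/(_ (fun x => L x == 0)) h; apply/eqP; apply: h.
    split=> [|a u v]; first by apply/eqP.
    rewrite !unfold_in => /eqP hu /eqP hv.
    by rewrite LD LZ hu hv scaler0 addr0.
  move=> y [] [a [b [c [d ->]]]]; rewrite unfold_in LB LD LZ !LU !scale1r.
    by rewrite fl subrr.
  by rewrite fr subrr.
pose g (x : tensor V W) : U := L (repr x).
have gE x : g (lproj (@bilin_rel R V W) x) = L x.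
  apply/eqP; rewrite -subr_eq0 -LB Lker //.
  by apply/lproj_eq; rewrite /lproj reprK.
have glin : linear g.
  move=> a x y; have [u ->] := lproj_surj x; have [v ->] := lproj_surj y.
  by rewrite -linearP !gE LD LZ.
pose gm := GRing.isLinear.Build R (tensor V W) U *:%R g glin.
pose G : {linear tensor V W -> U} := HB.pack g gm.
have GE v w : G (v \ox w) = f v w by rewrite [LHS]gE LU scale1r.
exists G => // g' g'E; apply: tensor_ind => [|a v w x ih]; first by rewrite !linear0.
by rewrite !linearP ih g'E GE.
Qed.

End TensorTheory.

(** A real vector space with a distinguished subset (meant to be its cone of
    positive elements) and a distinguished vector (meant to be its order unit);
    the axioms are the predicates that follow. *)

Record ouspace (R : realType) := OUSpace {
  carrier :> lmodType R;
  poscone : set carrier;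
  ounit : carrier }.

Arguments OUSpace {R} carrier poscone ounit.
Arguments poscone {R} V : rename.
Arguments ounit {R} V : rename.

Section OrderUnit.
Variables (R : realType).
Implicit Types V W : ouspace R.

Definition set_opp (V : lmodType R) (A : set V) : set V := [set - x | x in A].

Definition convex_cone (V : lmodType R) (C : set V) :=
  [/\ C 0, (forall x y, C x -> C y -> C (x + y)) &
      forall (a : R) x, 0 <= a -> C x -> C (a *: x)].

Definition order_unit V :=
  forall v : V, exists2 r : R, 0 < r & poscone V (r *: ounit V - v).

Definition archimedean V :=
  forall v : V, (forall eps : R, 0 < eps -> poscone V (eps *: ounit V + v)) ->
    poscone V v.

Definition ordered_with_unit V :=
  [/\ convex_cone (poscone V), poscone V `&` set_opp (poscone V) = [set 0] & order_unit V].

Definition function_system V := ordered_with_unit V /\ archimedean V.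

Definition arch_pos V : set V :=
  [set v | forall eps : R, 0 < eps -> poscone V (eps *: ounit V + v)].
Arguments arch_pos : clear implicits.

Definition arch_null V : set V := arch_pos V `&` set_opp (arch_pos V).
Arguments arch_null : clear implicits.

(** [lquot] divides by the span of [arch_null V], which is [arch_null V] itself
    as soon as [poscone V] is a convex cone, see [lspan_arch_null]. *)
Definition arch_proj V : {linear V -> lquot (arch_null V)} :=
  lproj (arch_null V).

Definition archimedeanization V : ouspace R :=
  OUSpace (lquot (arch_null V)) (arch_proj V @` arch_pos V)
    (arch_proj V (ounit V)).

Definition ou_isomorphism V W (f : {linear V -> W}) :=
  [/\ bijective f, f @` poscone V = poscone W & f (ounit V) = ounit W].

Lemma lspan_arch_null V : convex_cone (poscone V) -> order_unit V ->
  forall v, v \in lspan (arch_null V) <-> arch_null V v.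
Proof.
move=> [C0 CD CZ] eU.
have eC : poscone V (ounit V).
  have [r r0] := eU 0; rewrite subr0 => /(CZ r^-1).
  by rewrite scalerA mulVf ?gt_eqF// scale1r; apply; rewrite invr_ge0 ltW.
have D0 : arch_pos V 0 by move=> e e0; rewrite addr0; apply: CZ => //; exact: ltW.
have DD x y : arch_pos V x -> arch_pos V y -> arch_pos V (x + y).
  move=> hx hy e e0; have e2 : 0 < e / 2 by rewrite divr_gt0.
  rewrite [e]splitr scalerDl addrACA; apply: CD; [exact: hx | exact: hy].
have DZ (a : R) x : 0 <= a -> arch_pos V x -> arch_pos V (a *: x).
  rewrite le_eqVlt => /predU1P[<- _|a0 hx e e0]; first by rewrite scale0r.
  have -> : e *: ounit V + a *: x = a *: ((e / a) *: ounit V + x).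
    by rewrite scalerDr scalerA mulrC divfK ?gt_eqF.
  by apply: CZ; [exact: ltW | apply: hx; rewrite divr_gt0].
have NE x : arch_null V x <-> arch_pos V x /\ arch_pos V (- x).
  split=> [[hx [y hy yx]]|[hx hy]]; first by rewrite -yx opprK yx.
  by split=> //; exists (- x) => //; rewrite opprK.
have NZ (a : R) x : arch_null V x -> arch_null V (a *: x).
  move=> /NE[hx hNx]; apply/NE; case: (leP 0 a) => a0.
    by rewrite -scalerN; split; exact: DZ.
  have a0' : 0 <= - a by rewrite oppr_ge0 ltW.
  have -> : a *: x = (- a) *: - x by rewrite scalerN scaleNr opprK.
  by split; [exact: DZ | rewrite -scalerN opprK; exact: DZ].
move=> v; split=> [/asboolP/(_ (fun x => `[< arch_null V x >])) h|hv].
  apply/asboolP; apply: h => [|x hx]; last exact/asboolP.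
  split=> [|a x y /asboolP hx /asboolP hy]; apply/asboolP.
    by apply/NE; rewrite oppr0.
  have /NE[h1 h2] := NZ a _ hx; have /NE[h3 h4] := hy.
  by apply/NE; rewrite opprD; split; exact: DD.
by apply/asboolP => U _; apply.
Qed.

End OrderUnit.

Arguments ou_isomorphism {R} V W f.
Arguments arch_pos {R} V.
Arguments arch_null {R} V.
Arguments arch_proj {R} V.

Section MaxTensor.
Variables (R : realType) (V W : ouspace R).

Definition tensor_pos : set (tensor V W) :=
  [set z | exists (n : nat) (v : 'I_n -> V) (w : 'I_n -> W),
     [/\ forall i, poscone V (v i), forall i, poscone W (w i) &
         z = \sum_(i < n) v i \ox w i]].

Definition tensor_ou : ouspace R :=
  OUSpace (tensor V W) tensor_pos (ounit V \ox ounit W).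

Definition Smax : set {scalar tensor V W} :=
  [set r | (forall v w, poscone V v -> poscone W w -> 0 <= r (v \ox w)) /\
           r (ounit V \ox ounit W) = 1].

Definition tensor_max : ouspace R :=
  OUSpace (tensor V W) [set z | forall r, Smax r -> 0 <= r z]
    (ounit V \ox ounit W).

End MaxTensor.

(* Main.v *)
(** By a Hahn-Banach argument (Zorn's lemma on cones avoiding [- e]), in any
    ordered space with order unit [e] the states detect exactly the closure
    [arch_pos]; for the algebraic tensor cone the states are the elements of
    [Smax], which gives the equality of the two cones.  For
    [D `&` - D = {0}], a state [f] of [V] induces the slice map [f (x) id],
    which sends [D] into the Archimedean cone of [W], hence kills [D `&` - D];
    since states separate the points of [V], an element killed by all slices
    is zero. *)

Require Import Defs.
From HB Require Import structures.
From mathcomp Require Import all_boot all_order all_algebra.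
From mathcomp Require Import all_classical reals.

Set Implicit Arguments.
Unset Strict Implicit.
Unset Printing Implicit Defensive.

Import Order.TTheory GRing.Theory Num.Theory.
Local Open Scope classical_set_scope.
Local Open Scope ring_scope.

(** * States on a space with order unit: existence, separation, and the closure they detect *)

Section States.
Context {R : realType}.
Implicit Type V : ouspace R.

Definition is_state V (f : {scalar V}) :=
  (forall x, poscone V x -> 0 <= f x) /\ f (ounit V) = 1.

Lemma ounit_pos V : convex_cone (poscone V) -> order_unit V ->
  poscone V (ounit V).
Proof.
move=> [_ _ CZ] eU; have [r r0 /(CZ r^-1)] := eU 0.
rewrite subr0 scalerA mulVf ?gt_eqF// scale1r; apply.
by rewrite invr_ge0 ltW.
Qed.

(** If a maximal [M] missed both [x] and [- x], adjoining the ray through [x] would still avoid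
    [- e]: from [m + t *: x = - e] with [t > 0] one gets [- x = t^-1 *: (m + e)] in [M]. *)
Lemma maximal_cone V : convex_cone (poscone V) ->
    poscone V (ounit V) -> ~ poscone V (- ounit V) ->
  exists M : set V, [/\ convex_cone M, poscone V `<=` M, ~ M (- ounit V) &
    forall x, M x \/ M (- x)].
Proof.
move=> [C0 CD CZ] Ce CNe; set C := poscone V in C0 CD CZ Ce CNe *.
set e := ounit V in Ce CNe *.
(* phrased so that the empty set, i.e. the union of the empty chain, qualifies *)
pose P (A : set V) := [/\ forall x y, A x -> A y -> A (x + y),
  forall (a : R) x, 0 <= a -> A x -> A (a *: x),
  forall x c, C c -> A x -> A (x + c) & ~ A (- e)].
have PC : P C by split => // x c cC xC; exact: CD.
have [F FP Ftot|M [[MD MZ MCc MNe] Mmax]] := @Zorn_bigcup _ P.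
  split=> [x y [A FA Ax] [B FB By]|a x a0 [A FA Ax]|x c Cc [A FA Ax]|[A FA Ax]].
  - have [AB|BA] := Ftot _ _ FA FB.
    + by exists B => //; have [BD _ _ _] := FP _ FB; apply: BD => //; exact: AB.
    + by exists A => //; have [AD _ _ _] := FP _ FA; apply: AD => //; exact: BA.
  - by exists A => //; have [_ AZ _ _] := FP _ FA; exact: AZ.
  - by exists A => //; have [_ _ ACc _] := FP _ FA; exact: ACc.
  - by have [_ _ _] := FP _ FA; apply.
(* An empty [M] would not be maximal, since [C] itself satisfies [P]. *)
have [m Mm] : M !=set0.
  apply/set0P/eqP => M0; apply: (Mmax C) PC.
  by rewrite M0; split=> // /(_ 0 C0).
have M0 : M 0 by rewrite -(scale0r m); exact: MZ.
have CM : C `<=` M by move=> c Cc; rewrite -[c]add0r; exact: MCc.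
exists M; split => // x; have [|Mx] := pselect (M x); [by left|right].
pose B := [set m + t *: x | m in M & t in [set t : R | 0 <= t]].
apply: contrapT => MNx; apply: (Mmax B).
  split=> [y My|/(_ x)]; first by exists y => //; exists 0 => /=; rewrite ?scale0r ?addr0.
  by move=> BM; apply/Mx/BM; exists 0 => //; exists 1 => /=; rewrite ?scale1r ?add0r.
split.
- move=> _ _ [m1 Mm1 [t1 /= t10 <-]] [m2 Mm2 [t2 /= t20 <-]].
  exists (m1 + m2); first exact: MD.
  by exists (t1 + t2) => /=; [exact: addr_ge0|rewrite scalerDl addrACA].
- move=> a _ a0 [m1 Mm1 [t1 /= t10 <-]]; exists (a *: m1); first exact: MZ.
  by exists (a * t1) => /=; [exact: mulr_ge0|rewrite scalerDr scalerA].
- move=> _ c Cc [m1 Mm1 [t1 t10 <-]]; exists (m1 + c); first exact: MCc.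
  by exists t1 => //; rewrite addrAC.
- move=> [m1 Mm1 [t /= t0 te]].
  move: t0; rewrite le_eqVlt => /predU1P[t0|t0].
    by apply: MNe; rewrite -te -t0 scale0r addr0.
  apply: MNx; have -> : - x = t^-1 *: (m1 + e).
    rewrite -[e]opprK -te opprD addrA subrr add0r scalerN scalerA.
    by rewrite mulVf ?gt_eqF// scale1r.
  by apply: MZ; [rewrite invr_ge0 ltW|exact: MCc].
Qed.

(* Modulo the infinitesimals of a total cone every vector is a multiple of the
   order unit; the state reads off the coefficient. *)
Lemma state_exists V : convex_cone (poscone V) -> order_unit V ->
  ~ poscone V (- ounit V) -> exists f : {scalar V}, is_state f.
Proof.
move=> hC eU CNe; have Ce := ounit_pos hC eU.
have [M [[M0 MD MZ] CM MNe Mtot]] := maximal_cone hC Ce CNe.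
set e := ounit V in CNe MNe Ce *.
have Mneg (t : R) : M (t *: e) -> 0 <= t.
  move=> Mt; rewrite leNgt; apply/negP => t0; apply: MNe.
  have -> : - e = (- t)^-1 *: (t *: e).
    by rewrite scalerA invrN mulNr mulVf ?lt_eqF// scaleN1r.
  by apply: MZ => //; rewrite invr_ge0 oppr_ge0 ltW.
have Mpos (t : R) : 0 <= t -> M (t *: e) by move=> t0; apply: MZ => //; exact: CM.
(* [N] is the Archimedean closure of [M]; the infinitesimals are the [x] with both [x] and [- x] in
   [N]. *)
pose N x := forall s : R, 0 < s -> M (s *: e + x).
have ND x y : N x -> N y -> N (x + y).
  move=> Nx Ny s s0; rewrite [s]splitr scalerDl addrACA.
  by apply: MD; [apply: Nx|apply: Ny]; rewrite divr_gt0.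
have NZ (a : R) x : 0 <= a -> N x -> N (a *: x).
  rewrite le_eqVlt => /predU1P[<- _ s s0|a0 Nx s s0].
    by rewrite scale0r addr0; apply/Mpos/ltW.
  have -> : s *: e + a *: x = a *: ((s / a) *: e + x).
    by rewrite scalerDr scalerA mulrC divfK ?gt_eqF.
  by apply: MZ; [exact: ltW|apply: Nx; rewrite divr_gt0].
have Ne (t : R) : N (t *: e) -> 0 <= t.
  move=> Nt; apply/ler_addgt0Pr => s s0; apply: Mneg.
  by rewrite addrC scalerDl; exact: Nt.
(* [K x t]: [x] equals [t *: e] up to an infinitesimal, so [t] is the value of the state at [x]. *)
pose K x (t : R) := N (x - t *: e) /\ N (t *: e - x).
have KP a x y s t : K x s -> K y t -> K (a *: x + y) (a * s + t).
  have NN z : N z /\ N (- z) -> N (a *: z) /\ N (- (a *: z)).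
    have [a0 [? ?]|a0 [? ?]] := leP 0 a.
      by rewrite -scalerN; split; apply: NZ.
    have {}a0 : 0 <= - a by rewrite oppr_ge0 ltW.
    have -> : a *: z = - a *: - z by rewrite scalerN scaleNr opprK.
    by rewrite -scalerN opprK; split; apply: NZ.
  move=> [Nx1 Nx2] [Ny1 Ny2].
  have [|Na1 Na2] := NN (x - s *: e); first by rewrite opprB.
  have E : a *: x + y - (a * s + t) *: e = a *: (x - s *: e) + (y - t *: e).
    by rewrite scalerDl scalerDr -scalerA scalerN opprD addrACA.
  have E' : (a * s + t) *: e - (a *: x + y) = - (a *: (x - s *: e)) + (t *: e - y).
    by rewrite -opprB E opprD opprB.
  by rewrite /K E E'; split; exact: ND.
  have Kuniq x s t : K x s -> K x t -> s <= t.
  move=> [Ns1 Ns2] [Nt1 Nt2]; rewrite -subr_ge0; apply: Ne.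
  by rewrite scalerBl -(subrKA x); exact: ND.
(* The coefficient is a Dedekind cut: the supremum of the [t] with [x - t *: e] in [M], a set that
   the order unit makes nonempty and bounded. *)
have Kex x : exists t, K x t.
  pose E := [set t : R | M (x - t *: e)].
  have supE : has_sup E.
    split.
      have [r r0] := eU (- x); rewrite opprK => /CM Mr.
      by exists (- r); rewrite /E /= scaleNr opprK addrC.
    have [r r0 /CM Mr] := eU x; exists r => t /= Mt.
    rewrite -subr_ge0; apply: Mneg.
    by rewrite scalerBl -(subrKA x); exact: MD.
  exists (sup E); split=> s s0.
    have [t Et st] := sup_adherent s0 supE.
    have -> : s *: e + (x - sup E *: e) = (x - t *: e) + (t - (sup E - s)) *: e.
      by rewrite scalerBl subrKA scalerBl opprB addrCA.
    by apply: MD => //; apply: Mpos; rewrite subr_ge0 ltW.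
  (* Totality of [M] decides: the wrong sign would put [s + sup E], which exceeds the supremum, in
     [E]. *)
  rewrite addrA -scalerDl; have [Ms|] := Mtot (x - (s + sup E) *: e); last by rewrite opprB.
  have /(_ _ Ms) := sup_upper_bound supE.
  by rewrite gerDr leNgt s0.
pose g x := projT1 (cid (Kex x)).
have gK x : K x (g x) by rewrite /g; case: cid.
have gE x t : K x t -> g x = t.
  by move=> Kt; apply/eqP; rewrite eq_le !(Kuniq x).
have glin : scalar g by move=> a x y; apply/gE/KP.
pose gm := GRing.isLinear.Build R V R *%R g glin.
pose G : {scalar V} := HB.pack g gm.
exists G; split => [x Cx|] /=.
  (* Adding [x], which lies in [M], to [g x *: e - x], which lies in [N], gives [g x *: e] in
     [N]. *)
  apply: Ne => s s0; have [_ /(_ s s0) h] := gK x.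
  rewrite -[G x *: e](subrK x) addrA; apply: MD => //; exact: CM.
apply: gE; rewrite /K scale1r subrr.
by split=> s s0; rewrite addr0; apply/Mpos/ltW.
Qed.

(** Any state for the cone enlarged by the ray through [- u] is a state of [V] with [f u <= 0]; one
    exists because the enlarged cone still avoids [- ounit V]. *)
Lemma state_separation V (u : V) : convex_cone (poscone V) -> order_unit V ->
  ~ poscone V u -> exists2 f : {scalar V}, is_state f & f u <= 0.
Proof.
move=> hC eU Cu; have Ce := ounit_pos hC eU; have [C0 CD CZ] := hC.
pose C' := [set c - t *: u | c in poscone V & t in [set t : R | 0 <= t]].
have CC' : poscone V `<=` C'.
  by move=> c Cc; exists c => //; exists 0 => /=; rewrite ?scale0r ?subr0.
pose V' := OUSpace V C' (ounit V).
have [||CNe|f [fC fe]] := @state_exists V'.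
- split; first exact: CC'.
  + move=> _ _ [c1 Cc1 [t1 /= t10 <-]] [c2 Cc2 [t2 /= t20 <-]].
    exists (c1 + c2); first exact: CD.
    by exists (t1 + t2) => /=; [exact: addr_ge0|rewrite scalerDl opprD addrACA].
  + move=> a _ a0 [c1 Cc1 [t1 /= t10 <-]]; exists (a *: c1); first exact: CZ.
    by exists (a * t1) => /=; [exact: mulr_ge0|rewrite scalerBr scalerA].
- by move=> v; have [r r0 /CC' h] := eU v; exists r.
- apply: Cu; have [c Cc [t /= t0 te]] := CNe.
  have tu : t *: u = c + ounit V by rewrite -[ounit V]opprK -te opprB addrC subrK.
  (* If [t = 0], then [- ounit V] is positive, and the order unit property makes every vector
     positive, [u] included. *)
  move: t0; rewrite le_eqVlt => /predU1P[t0|t0].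
    have cN : c = - ounit V by apply/eqP; rewrite -addr_eq0 -tu -t0 scale0r.
    have [r r0 Cr] := eU (- u).
    rewrite -[u](addKr (r *: ounit V)) -scalerN -cN; apply: CD.
      by apply: CZ => //; exact: ltW.
    by move: Cr; rewrite opprK.
  have -> : u = t^-1 *: (c + ounit V).
    by rewrite -tu scalerA mulVf ?gt_eqF// scale1r.
  by apply: CZ; [rewrite invr_ge0 ltW|exact: CD].
- exists f; first by split=> // x /CC'; exact: fC.
  rewrite -oppr_ge0 -linearN; apply: fC.
  by exists 0 => //; exists 1 => /=; rewrite ?scale1r ?sub0r.
Qed.

(** If [s *: ounit V + v] is not positive for some [s > 0], a separating state gives [s + f v <= 0],
    so [f v < 0]. The other inclusion lets [s] tend to 0. *)
Lemma arch_pos_state V : convex_cone (poscone V) -> order_unit V ->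
  arch_pos V = [set v | forall f : {scalar V}, is_state f -> 0 <= f v].
Proof.
move=> hC eU; apply/seteqP; split=> v /= h.
  move=> f [fC fe]; apply/ler_addgt0Pr => s s0.
  by rewrite addrC -[s]mulr1 -fe -linearP; apply/fC/h.
move=> s s0; apply: contrapT => /(state_separation hC eU)[f fs].
have [_ fe] := fs; rewrite linearP fe /= mulr1 leNgt => /negP; apply.
by rewrite ltr_wpDr // h.
Qed.

(** A vector killed by all states lies in the Archimedean closure together with its opposite, hence
    both lie in the cone, which is proper. *)
Lemma state_nondegenerate V (v : V) : function_system V ->
  (forall f : {scalar V}, is_state f -> f v = 0) -> v = 0.
Proof.
move=> [[hC C0 eU] aV] fv.
have pos w : (forall f : {scalar V}, is_state f -> f w = 0) -> poscone V w.
  move=> fw; suff : arch_pos V w by exact: aV.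
  by rewrite arch_pos_state //= => f fs; rewrite fw.
have : [set (0 : V)] v; last by [].
rewrite -C0; split; first exact: pos.
exists (- v); last exact: opprK.
by apply: pos => f fs; rewrite linearN fv ?oppr0.
Qed.

End States.

(** * Calculus of elementary tensors *)

Section TensorProduct.
Context {R : realType}.
Implicit Types V W : ouspace R.

Lemma tmulDl (V W : lmodType R) (v v' : V) (w : W) :
  (v + v') \ox w = v \ox w + v' \ox w.
Proof. by have := tmul_linearl w 1 v v'; rewrite !scale1r. Qed.

Lemma tmulDr (V W : lmodType R) (v : V) (w w' : W) :
  v \ox (w + w') = v \ox w + v \ox w'.
Proof. by have := tmul_linearr v 1 w w'; rewrite !scale1r. Qed.

Lemma tmul0l (V W : lmodType R) (w : W) : (0 : V) \ox w = 0.
Proof. by apply: (addIr ((0 : V) \ox w)); rewrite -tmulDl !add0r. Qed.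

Lemma tmul0r (V W : lmodType R) (v : V) : v \ox (0 : W) = 0.
Proof. by apply: (addIr (v \ox (0 : W))); rewrite -tmulDr !add0r. Qed.

Lemma tmulZl (V W : lmodType R) a (v : V) (w : W) :
  (a *: v) \ox w = a *: (v \ox w).
Proof. by have := tmul_linearl w a v 0; rewrite !addr0 tmul0l addr0. Qed.

Lemma tmulZr (V W : lmodType R) a (v : V) (w : W) :
  v \ox (a *: w) = a *: (v \ox w).
Proof. by have := tmul_linearr v a w 0; rewrite !addr0 tmul0r addr0. Qed.

Lemma tmulNl (V W : lmodType R) (v : V) (w : W) : (- v) \ox w = - (v \ox w).
Proof. by rewrite -scaleN1r tmulZl scaleN1r. Qed.

Lemma tmulNr (V W : lmodType R) (v : V) (w : W) : v \ox (- w) = - (v \ox w).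
Proof. by rewrite -scaleN1r tmulZr scaleN1r. Qed.

(** The cross terms cancel. With multiples of the units for [v] and [w], all factors on the left can
    be made positive, which yields the order unit of the tensor cone. *)
Lemma tmul_polarization (V W : lmodType R) (v v' : V) (w w' : W) :
  (v - v') \ox (w + w') + (v + v') \ox (w - w') =
  2 *: (v \ox w - v' \ox w').
Proof.
rewrite !tmulDl !tmulDr !tmulNl !tmulNr addrACA.
rewrite [X in X + _]addrACA subrr addr0 [X in _ + X]addrACA addNr add0r.
by rewrite scaler_nat mulrnBl !mulr2n opprD.
Qed.

Lemma tmul_sumr (V W : lmodType R) I (r : seq I) (v : V) (w : I -> W) :
  v \ox (\sum_(i <- r) w i) = \sum_(i <- r) v \ox w i.
Proof. by elim/big_rec2: _ => [|i x y _ <-]; rewrite ?tmul0r ?tmulDr. Qed.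

(** * Slice maps and vanishing of tensors *)

Lemma tensor_sum (V W : lmodType R) (z : tensor V W) :
  exists s : seq (V * W), z = \sum_(p <- s) p.1 \ox p.2.
Proof.
elim/tensor_ind: z => [|a v w x [s ->]]; first by exists [::]; rewrite big_nil.
by exists ((a *: v, w) :: s); rewrite big_cons tmulZl.
Qed.

Lemma slice_exists (V W : lmodType R) (f : {scalar V}) :
  exists g : {linear tensor V W -> W}, forall v w, g (v \ox w) = f v *: w.
Proof.
have [w a v v'|v a w w'|g gE _] := @tensor_universal _ _ _ W (fun v w => f v *: w).
- by rewrite /= linearP scalerDl scalerA.
- by rewrite /= scalerDr !scalerA mulrC.
by exists g.
Qed.

(* If some state [f] does not kill the first left factor [p.1], vanishing of the
   slice by [f] expresses [p.2] by the other right factors, and substituting it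
   shortens the sum by one term. *)
Lemma slice_nondegenerate V (W : lmodType R) (z : tensor V W) :
    function_system V ->
    (forall (f : {scalar V}) (g : {linear tensor V W -> W}), is_state f ->
      (forall v w, g (v \ox w) = f v *: w) -> g z = 0) ->
  z = 0.
Proof.
move=> hV; have [s ->] := tensor_sum z.
have [n] := ubnP (size s); elim: n => // n IHn in s *.
case: s => [_ _|[v w] s /= sn hz]; first by rewrite big_nil.
have [v0|] := pselect (v = 0).
  move: hz; rewrite big_cons v0 tmul0l add0r => hz; exact: IHn.
(* By contraposition: if the sum were nonzero, every state would kill [v], forcing [v = 0]. *)
move=> /eqP; apply: contra_neqP => /eqP znz; apply: state_nondegenerate => // f fs.
apply: contrapT => /eqP fv; apply: (negP znz); apply/eqP.
have [g gE] := slice_exists W f.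
have wE : w = - (\sum_(p <- s) (f p.1 / f v) *: p.2).
  apply: (scalerI fv); rewrite scalerN scaler_sumr; apply/eqP.
  rewrite -addr_eq0 -gE -[X in _ == X](hz f g fs gE) big_cons linearD linear_sum /=.
  rewrite (inj_eq (addrI _)); apply/eqP/eq_bigr => p _.
  by rewrite gE scalerA mulrCA mulfV ?mulr1.
(* Substituting [wE] into [v \ox w] spreads it over the left factors of the remaining terms. *)
pose s' := [seq (p.1 - (f p.1 / f v) *: v, p.2) | p <- s].
have zE : \sum_(p <- (v, w) :: s) p.1 \ox p.2 = \sum_(p <- s') p.1 \ox p.2.
  rewrite big_cons big_map /= {1}wE tmulNr tmul_sumr -sumrN -big_split /=.
  apply: eq_bigr => p _.
  by rewrite tmulDl tmulNl tmulZl tmulZr addrC.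
by move: hz; rewrite zE => hz; apply: IHn => //; rewrite size_map.
Qed.

(** * Order structure of the algebraic tensor product *)

Lemma tensor_pos_tmul V W v w : poscone V v -> poscone W w ->
  poscone (tensor_ou V W) (v \ox w).
Proof.
move=> Cv Cw; exists 1%N, (fun=> v), (fun=> w); split=> //.
by rewrite big_ord1.
Qed.

Lemma tensor_pos_cone V W : convex_cone (poscone V) ->
  convex_cone (V := tensor V W) (poscone (tensor_ou V W)).
Proof.
move=> [_ _ CZ]; split.
- by exists 0%N, (fun=> 0), (fun=> 0); split=> [[]|[]|] //; rewrite big_ord0.
- move=> _ _ [n1 [v1 [w1 [Cv1 Cw1 ->]]]] [n2 [v2 [w2 [Cv2 Cw2 ->]]]].
  exists (n1 + n2)%N.
  exists (fun i => match fintype.split i with inl j => v1 j | inr j => v2 j end).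
  exists (fun i => match fintype.split i with inl j => w1 j | inr j => w2 j end).
  split=> [i|i|]; [by case: (fintype.split i)|by case: (fintype.split i)|].
  rewrite big_split_ord /=; congr (_ + _); apply: eq_bigr => i _.
    by rewrite (unsplitK (inl i)).
  by rewrite (unsplitK (inr i)).
- move=> a _ a0 [n [v [w [Cv Cw ->]]]].
  exists n, (fun i => a *: v i), w; split=> // [i|]; first exact: CZ.
  by rewrite scaler_sumr; apply: eq_bigr => i _; rewrite tmulZl.
Qed.

(** Bounds add up, so it suffices to dominate one elementary tensor, which polarization does from
    two-sided bounds on its factors. *)
Lemma tensor_order_unit V W : convex_cone (poscone V) ->
  order_unit V -> convex_cone (poscone W) -> order_unit W ->
  order_unit (tensor_ou V W).
Proof.
move=> hV uV hW uW; have [C0 CD CZ] := tensor_pos_cone W hV.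
have bound (U : ouspace R) (u : U) : convex_cone (poscone U) -> order_unit U ->
    exists r : R, [/\ 0 < r, poscone U (r *: ounit U - u) &
                      poscone U (r *: ounit U + u)].
  move=> hU uU; have [_ UD UZ] := hU; have Ue := ounit_pos hU uU.
  have [r1 r10 h1] := uU u; have [r2 r20 h2] := uU (- u).
  rewrite opprK in h2; exists (r1 + r2); split; first exact: addr_gt0.
    by rewrite scalerDl addrAC; apply: UD => //; apply: UZ => //; exact: ltW.
  by rewrite scalerDl -addrA; apply: UD => //; apply: UZ => //; exact: ltW.
elim/tensor_ind=> [|a v w x [t t0 ht]].
  exists 1; rewrite // subr0 scale1r; apply: tensor_pos_tmul; exact: ounit_pos.
have [r [r0 rv1 rv2]] := bound V (a *: v) hV uV.
have [s [s0 sw1 sw2]] := bound W w hW uW.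
exists (r * s + t); first by rewrite addr_gt0 ?mulr_gt0.
rewrite /= scalerDl opprD addrACA; apply: (CD) => //.
have -> : (r * s) *: (ounit V \ox ounit W) - a *: (v \ox w) =
    2^-1 *: ((r *: ounit V - a *: v) \ox (s *: ounit W + w)
           + (r *: ounit V + a *: v) \ox (s *: ounit W - w)).
  rewrite tmul_polarization scalerA mulVf ?pnatr_eq0// scale1r.
  by rewrite tmulZl tmulZr tmulZl scalerA [s * r]mulrC.
by apply: CZ; [rewrite invr_ge0 ler0n|apply: CD; exact: tensor_pos_tmul].
Qed.

Lemma tensor_arch_null V W : function_system V -> function_system W ->
  arch_pos (tensor_ou V W) `&` set_opp (arch_pos (tensor_ou V W)) = [set 0].
Proof.
move=> hV hW; have [[cV V0 uV] aV] := hV; have [[cW W0 uW] aW] := hW.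
have [WC0 WCD WCZ] := cW.
apply/seteqP; split=> [z [Dz [z' Dz' z'E]]|_ ->]; last first.
  have D0 : arch_pos (tensor_ou V W) 0.
    move=> s s0; rewrite addr0 /=; have [_ _ CZ] := tensor_pos_cone W cV.
    by apply: CZ; [exact: ltW|apply: tensor_pos_tmul; exact: ounit_pos].
  by split=> //; exists 0; rewrite ?oppr0.
apply: slice_nondegenerate => // f g [fC fe] gE.
(* The slice is positive on the tensor cone and sends [ounit V \ox ounit W] to [ounit W], so the
   Archimedean property of [W] applies. *)
have gD x : arch_pos (tensor_ou V W) x -> poscone W (g x).
  move=> Dx; apply: aW => s s0.
  have -> : s *: ounit W + g x = g (s *: (ounit V \ox ounit W) + x).
    by rewrite linearP gE fe scale1r.
  have [n [v [w [Cv Cw ->]]]] := Dx s s0; rewrite linear_sum.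
  elim/big_rec: _ => // i y _ Cy; apply: WCD => //.
  by rewrite gE; apply: WCZ => //; exact: fC.
suff : [set (0 : W)] (g z) by [].
rewrite -W0; split; first exact: gD.
by exists (g z'); [exact: gD|rewrite -linearN z'E].
Qed.

(** The tensor cone is proper because it sits inside its Archimedean closure, already known to be
    proper. *)
Lemma tensor_ordered_with_unit V W : function_system V -> function_system W ->
  ordered_with_unit (tensor_ou V W).
Proof.
move=> hV hW; have [[cV V0 uV] aV] := hV; have [[cW W0 uW] aW] := hW.
have cT := tensor_pos_cone W cV; have [C0 CD CZ] := cT.
have uT := tensor_order_unit cV uV cW uW.
split=> //; apply/seteqP; split=> [z [Cz [z' Cz' z'E]]|_ ->]; last first.
  by split=> //; exists 0; rewrite ?oppr0.
have CD' : poscone (tensor_ou V W) `<=` arch_pos (tensor_ou V W).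
  move=> x Cx s s0; apply: CD => //; apply: CZ; first exact: ltW.
  exact: (@ounit_pos _ (tensor_ou V W)).
rewrite -(tensor_arch_null hV hW); split; first exact: CD'.
by exists z' => //; exact: CD'.
Qed.

(** Elements of the tensor cone are sums of elementary positive tensors, so positivity need only be
    tested on those. *)
Lemma Smax_state V W (r : {scalar tensor V W}) :
  @Smax R V W r <-> is_state (V := tensor_ou V W) r.
Proof.
split=> -[rC re]; split=> //.
  move=> _ [n [v [w [Cv Cw ->]]]]; rewrite linear_sum.
  by apply: sumr_ge0 => i _; exact: rC.
by move=> v w Cv Cw; apply: rC; exact: tensor_pos_tmul.
Qed.

End TensorProduct.

Theorem theorem3p1 (R : realType) (V W : ouspace R)
    (hV : function_system V) (hW : function_system W) :
  let D := arch_pos (tensor_ou V W) in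
  [/\ ordered_with_unit (tensor_ou V W),
      D `&` set_opp D = [set 0],
      poscone (tensor_max V W) = D &
      ou_isomorphism (tensor_max V W) (archimedeanization (tensor_ou V W))
        (arch_proj (tensor_ou V W))].
Proof.
move=> D; have oT := tensor_ordered_with_unit hV hW.
have D0 := tensor_arch_null hV hW; have [cT _ uT] := oT.
have DE : poscone (tensor_max V W) = D.
  rewrite /D arch_pos_state //; apply/seteqP.
  by split=> z /= h f /Smax_state; exact: h.
split=> //; split=> //; last by rewrite DE.
(* The null space is zero, so each class has a single representative and [repr] inverts the
   projection. *)
exists (fun x => repr x) => x; last exact: reprK.
apply/eqP; rewrite -subr_eq0; apply/eqP.
have N0 z : arch_null (tensor_ou V W) z -> z = 0 by rewrite /arch_null D0.
by apply/N0/lspan_arch_null => //; apply/lproj_eq; exact: reprK.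
Qed.
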